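(* Let $n\ge 2$ and let $a\in\mathbb{C}$ with $|a|\neq 0,1$. Suppose that $J_n(a)$ is unitarily similar to a block matrix $\begin{bmatrix} A & *\\ 0 & *\end{bmatrix}$, where $A$ is of size $m\times m$ with $1\le m<n$. Then $W(A)$ is contained in the interior of $W(J_n(a))$.
   Context: For $n\ge 1$ and $a\in\mathbb{C}$, the KMS matrix $J_n(a)$ is the $n\times n$ strictly upper-triangular matrix whose $(i,j)$ entry is $a^{j-i}$ if $i<j$ and $0$ if $i\ge j$. The numerical range of an $n\times n$ complex matrix $A$ is $W(A)=\{\langle Ax,x\rangle: x\in\mathbb{C}^n,\ \|x\|=1\}$. The symbols $*$ denote arbitrary blocks of appropriate sizes. *)

(* Defs.v *)
From mathcomp Require Export all_boot all_order all_algebra.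
From mathcomp Require Export spectral sesquilinear.
From mathcomp Require Export all_classical all_reals topology normedtype.
From mathcomp Require Export complex.

Set Implicit Arguments.
Unset Strict Implicit.
Unset Printing Implicit Defensive.

Import Order.TTheory GRing.Theory Num.Theory.
Import numFieldNormedType.Exports.

Local Open Scope classical_set_scope.
Local Open Scope ring_scope.
Local Open Scope sesquilinear_scope.

Definition KMS (C : numClosedFieldType) (n : nat) (a : C) : 'M[C]_n :=
  \matrix_(i, j) if (i < j)%N then a ^+ (j - i)%N else 0.

(* dotmx is defined on row vectors, linear on the left and conjugate-linear on
   the right: inner u v = \sum_i u_i * (v_i)^*. *)
Definition inner (C : numClosedFieldType) (n : nat) (u v : 'cV[C]_n) : C :=
  dotmx u^T v^T.

Definition enorm (C : numClosedFieldType) (n : nat) (x : 'cV[C]_n) : C :=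
  sqrtC (inner x x).

Definition numrange (C : numClosedFieldType) (n : nat) (A : 'M[C]_n) : set C :=
  [set inner (A *m x) x | x in [set x : 'cV[C]_n | enorm x = 1]].

Definition unitarily_similar (C : numClosedFieldType) (n : nat)
    (A B : 'M[C]_n) : Prop :=
  exists2 U : 'M[C]_n, U \is unitarymx & B = U *m A *m U^t*.

(* Main.v *)
(* Let x be a unit vector of an invariant subspace of dimension m < n. Its last
   coordinate vanishes. The map v |-> <Jv, v> / <v, v> is a submersion at x
   unless (J - z)^* x = w (J - z) x for some unimodular w, where z = <Jx, x>.
   In that case the two-term recurrences satisfied by the entries of Jx and
   J^* x propagate the vanishing of the last coordinate and give x = 0; the
   exceptional case w = -1 is where |a| <> 1 is needed. Surjectivity onto a
   neighbourhood of z is explicit: along x + s h the equation for s reads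
   s + g |s|^2 = k, which is a real quadratic equation for |s|^2. *)

Require Import Defs.
From mathcomp Require Import ring.
Set Implicit Arguments.
Unset Strict Implicit.
Unset Printing Implicit Defensive.

Import Order.TTheory GRing.Theory Num.Theory.
Import numFieldNormedType.Exports.

Local Open Scope classical_set_scope.
Local Open Scope ring_scope.
Local Open Scope sesquilinear_scope.

(** * Solving a real-linear equation with a quadratic perturbation *)

(** Put s = k - g rho with rho real. The equation becomes |s|^2 = rho, that is |g|^2 rho^2 - b rho +
    |k|^2 = 0 with b = 1 + 2 Re (k conj g). The bound on |g| |k| makes its discriminant
    nonnegative. *)
Lemma perturbed_identity_solution (C : numClosedFieldType) (g k : C) :
  4 * (`|g| * `|k|) <= 1 -> exists s, s + g * (s * s^*) = k.
Proof.
set t := `|g| * `|k| => t_le.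
have t_ge0 : 0 <= t by rewrite mulr_ge0.
set e := k * g^* + k^* * g.
have e_conj : e^* = e by rewrite rmorphD !rmorphM /= !conjCK addrC.
have e_real : e \is Num.real by rewrite CrealE e_conj.
have e_ge : - (2 * t) <= e.
  have : `|e| <= 2 * t.
    apply: le_trans (ler_normD _ _) _.
    rewrite !normrM !norm_conjC /t.
    have -> : `|k| * `|g| + `|k| * `|g| = 2 * (`|g| * `|k|) by ring.
    by [].
  by move=> /(real_lerNnormlW e_real).
set b := 1 + e.
have b_ge : 2 * t <= b.
  rewrite /b -subr_ge0; apply: le_trans (_ : 1 - 4 * t <= _); first by rewrite subr_ge0.
  rewrite -subr_ge0 (_ : _ - _ = e - - (2 * t)) ?subr_ge0 //.
  by ring.
have b_gt0 : 0 < b.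
  have : (1 - 2 * t) + 2 * t <= b + b by apply: lerD; rewrite // /b lerD2l.
  by rewrite subrK -mulr2n => /(lt_le_trans ltr01); rewrite pmulrn_lgt0.
set r := sqrtC (b ^+ 2 - 4 * t ^+ 2).
have rE : r ^+ 2 = b ^+ 2 - 4 * t ^+ 2 by rewrite sqrtCK.
have r_ge0 : 0 <= r.
  rewrite sqrtC_ge0 (_ : _ - _ = (b - 2 * t) * (b + 2 * t)); last by ring.
  by apply: mulr_ge0; [rewrite subr_ge0 | apply: addr_ge0; rewrite ?mulr_ge0 // ltW].
have br_gt0 : 0 < b + r by rewrite ltr_wpDr.
have br_neq0 : b + r != 0 by rewrite gt_eqF.
(* The root (b - r) / (2 |g|^2), rationalised so that it also makes sense for g = 0. *)
set rho := 2 * (k * k^*) / (b + r).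
have rho_conj : rho^* = rho.
  apply: CrealP; rewrite ger0_real // /rho -normCK.
  by rewrite divr_ge0 ?mulr_ge0 ?exprn_ge0 ?ler0n // ltW.
have t2 : t ^+ 2 = g * g^* * (k * k^*) by rewrite -!normCK exprMn.
have rho_root : g * g^* * rho ^+ 2 - b * rho + k * k^* = 0.
  have -> : g * g^* * rho ^+ 2 - b * rho + k * k^* =
      k * k^* * (r ^+ 2 - (b ^+ 2 - 4 * (g * g^* * (k * k^*)))) / (b + r) ^+ 2.
    by rewrite /rho; field.
  by rewrite rE t2 subrr mulr0 mul0r.
exists (k - g * rho).
rewrite rmorphB rmorphM /= rho_conj.
have -> : (k - g * rho) * (k^* - g^* * rho) =
    rho + (g * g^* * rho ^+ 2 - b * rho + k * k^*) by rewrite /b /e; ring.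
by rewrite rho_root addr0 subrK.
Qed.

(** The map s -> alpha s + beta conj s has real determinant |alpha|^2 - |beta|^2. Moving the eta
    term to the left and applying the inverse map reduces to [perturbed_identity_solution], whose
    smallness condition holds for small zeta. *)
Lemma perturbed_real_linear_solution (C : numClosedFieldType)
    (alpha beta gamma eta : C) :
  `|alpha| != `|beta| ->
  exists2 d : C, 0 < d & forall zeta, `|zeta| < d ->
    exists s, alpha * s + beta * s^* + gamma * (s * s^*) =
              zeta * (1 + s * s^* * eta).
Proof.
move=> neq_ab.
pose D := alpha * alpha^* - beta * beta^*.
have D_neq0 : D != 0.
  rewrite /D -!normCK subr_eq0; apply: contra neq_ab.
  by rewrite eqrXn2.
have D_conj : D^* = D by rewrite /D rmorphB !rmorphM /= !conjCK; ring.
pose inv w := (alpha^* * w - beta * w^*) / D.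
have invK w : alpha * inv w + beta * (inv w)^* = w.
  rewrite /inv rmorphM rmorphB !rmorphM fmorphV /= !conjCK D_conj.
  transitivity ((alpha * alpha^* - beta * beta^*) * w / D); first by ring.
  by rewrite -/D mulrAC mulfV ?mul1r.
have [kap kap_ge0 inv_le] : exists2 kap : C,
    0 <= kap & forall w, `|inv w| <= kap * `|w|.
  exists ((`|alpha| + `|beta|) / `|D|); first by rewrite divr_ge0 ?addr_ge0.
  move=> w; rewrite /inv normrM normfV mulrAC ler_wpM2r ?invr_ge0 //.
  by apply: le_trans (ler_normB _ _) _; rewrite !normrM !norm_conjC mulrDl.
(* For |zeta| <= 1, 4 |g| |k| is at most N |zeta|; the added 1 in M makes the radius 1 / M well
   defined and at most 1. *)
have N_ge0 : 0 <= 4 * (kap ^+ 2 * (`|gamma| + `|eta|)).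
  apply: mulr_ge0; rewrite ?ler0n //.
  by apply: mulr_ge0; [exact: exprn_ge0 | exact: addr_ge0].
set N := 4 * _ in N_ge0; pose M := 1 + N.
have M_ge1 : 1 <= M by rewrite lerDl.
have M_gt0 : 0 < M by rewrite (lt_le_trans ltr01).
exists M^-1; first by rewrite invr_gt0.
move=> zeta zeta_lt.
have zeta_le1 : `|zeta| <= 1.
  by rewrite (le_trans (ltW zeta_lt)) // invf_le1.
have [|s sE] :=
  @perturbed_identity_solution C (inv (gamma - zeta * eta)) (inv zeta).
  apply: (@le_trans _ _ (N * `|zeta|)).
    rewrite /N -[4 * _ * _]mulrA; apply: ler_wpM2l; first by rewrite ler0n.
    apply: le_trans (_ : (kap * `|gamma - zeta * eta|) * (kap * `|zeta|) <= _).
      by rewrite ler_pM.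
    rewrite (_ : _ * _ * _ = kap ^+ 2 * (`|gamma - zeta * eta| * `|zeta|)); last by ring.
    rewrite -mulrA ler_wpM2l ?exprn_ge0 // ler_wpM2r //.
    by rewrite (le_trans (ler_normB _ _)) // lerD2l normrM ler_piMl.
  apply: le_trans (_ : M * M^-1 <= _); last by rewrite mulfV // gt_eqF.
  apply: ler_pM => //; last exact: ltW.
  by rewrite lerDr.
exists s.
have rho_conj : (s * s^*)^* = s * s^* by rewrite rmorphM /= conjCK mulrC.
(* [inv] is only real-linear, but |s|^2 is real and can be pulled out. *)
have inv_sE : inv (zeta - (gamma - zeta * eta) * (s * s^*)) = s.
  rewrite -{3}(addrK (inv (gamma - zeta * eta) * (s * s^*)) s) sE /inv.
  by rewrite !rmorphB /= rmorphM /= rho_conj rmorphB; ring.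
have := invK (zeta - (gamma - zeta * eta) * (s * s^*)).
by rewrite inv_sE => ->; ring.
Qed.

(** * Inner product and Rayleigh quotients *)

Lemma innerE (C : numClosedFieldType) n (u v : 'cV[C]_n) :
  inner u v = (v^t* *m u) 0 0.
Proof.
by rewrite /inner dotmxE trmxK !mxE; apply: eq_bigr => i _; rewrite !mxE mulrC.
Qed.

Lemma inner_sum (C : numClosedFieldType) n (u v : 'cV[C]_n) :
  inner u v = \sum_i u i 0 * (v i 0)^*.
Proof. by rewrite innerE !mxE; apply: eq_bigr => i _; rewrite !mxE mulrC. Qed.

Lemma innerDl (C : numClosedFieldType) n (u u' v : 'cV[C]_n) :
  inner (u + u') v = inner u v + inner u' v.
Proof. by rewrite !innerE mulmxDr mxE. Qed.

Lemma innerZl (C : numClosedFieldType) n c (u v : 'cV[C]_n) :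
  inner (c *: u) v = c * inner u v.
Proof. by rewrite !innerE -scalemxAr mxE. Qed.

Lemma inner_conj (C : numClosedFieldType) n (u v : 'cV[C]_n) :
  (inner u v)^* = inner v u.
Proof.
rewrite !inner_sum rmorph_sum; apply: eq_bigr => i _.
by rewrite rmorphM /= conjCK mulrC.
Qed.

Lemma innerDr (C : numClosedFieldType) n (u v v' : 'cV[C]_n) :
  inner u (v + v') = inner u v + inner u v'.
Proof. by rewrite -inner_conj innerDl rmorphD /= !inner_conj. Qed.

Lemma innerZr (C : numClosedFieldType) n c (u v : 'cV[C]_n) :
  inner u (c *: v) = c^* * inner u v.
Proof. by rewrite -inner_conj innerZl rmorphM /= inner_conj. Qed.

Lemma inner_adj (C : numClosedFieldType) m n (A : 'M[C]_(m, n)) u v :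
  inner (A *m u) v = inner u (A^t* *m v).
Proof. by rewrite !innerE trmx_mul map_mxM trmxCK mulmxA. Qed.

Lemma inner_ge0 (C : numClosedFieldType) n (u : 'cV[C]_n) : 0 <= inner u u.
Proof. by rewrite inner_sum sumr_ge0 // => i _; rewrite -normCK exprn_ge0. Qed.

Lemma inner_eq0 (C : numClosedFieldType) n (u : 'cV[C]_n) :
  (inner u u == 0) = (u == 0).
Proof.
apply/eqP/eqP => [|->]; last by rewrite innerE mulmx0 mxE.
rewrite inner_sum => /eqP; rewrite psumr_eq0 => [/allP u0|i _]; last first.
  by rewrite -normCK exprn_ge0.
apply/colP => i; rewrite mxE; apply/eqP.
by have := u0 i (mem_index_enum i); rewrite -normCK sqrf_eq0 normr_eq0.
Qed.

Lemma enorm_eq1 (C : numClosedFieldType) n (x : 'cV[C]_n) :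
  enorm x = 1 <-> inner x x = 1.
Proof.
by rewrite /enorm; split=> [x1|->]; rewrite ?sqrtC1 // -[LHS]sqrtCK x1 expr1n.
Qed.

Lemma numrange_quotient (C : numClosedFieldType) n (A : 'M[C]_n) (v : 'cV[C]_n) :
  v != 0 -> numrange A (inner (A *m v) v / inner v v).
Proof.
move=> v_neq0; set r := sqrtC (inner v v).
have r_ge0 : 0 <= r by rewrite sqrtC_ge0 inner_ge0.
have r_neq0 : r != 0 by rewrite sqrtC_eq0 inner_eq0.
have vv : inner v v = r ^+ 2 by rewrite sqrtCK.
have r_conj : r^-1^* = r^-1 by apply: CrealP; rewrite ger0_real // invr_ge0.
exists (r^-1 *: v).
  by apply/enorm_eq1; rewrite innerZl innerZr vv r_conj; field.
by rewrite -scalemxAr innerZl innerZr r_conj vv; field.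
Qed.

(* If all |<h, w1>| = |<w2, h>|, the choices h = w1, w2 give equality in
   Cauchy-Schwarz. *)
Lemma unimodular_multiple (C : numClosedFieldType) n (w1 w2 : 'cV[C]_n) :
  inner w1 w1 = `|inner w1 w2| -> inner w2 w2 = `|inner w1 w2| ->
  exists2 w : C, w * w^* = 1 & w1 = w *: w2.
Proof.
move=> w11 w22; have [w2_eq0|w2_neq0] := eqVneq w2 0.
  exists 1; first by rewrite rmorph1 mulr1.
  apply/eqP; rewrite scale1r w2_eq0 -inner_eq0 w11.
  by rewrite w2_eq0 innerE trmx0 map_mx0 mul0mx mxE normr0.
have p_neq0 : inner w2 w2 != 0 by rewrite inner_eq0.
have p_conj : (inner w2 w2)^* = inner w2 w2 by rewrite inner_conj.
set q := inner w1 w2 in w11 w22; set p := inner w2 w2 in w22 p_neq0 p_conj.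
have qq : q * q^* = p ^+ 2 by rewrite -normCK -w22.
(* The projection coefficient of w1 on w2: the residue has squared norm p - |q|^2 / p = 0. *)
exists (q / p).
  rewrite rmorphM fmorphV /= p_conj mulrACA qq; by field.
apply/eqP; rewrite -subr_eq0 -scaleN1r scalerA mulN1r -inner_eq0.
rewrite innerDl !innerDr !innerZl !innerZr -(inner_conj w1 w2) -/q -/p w11 -w22.
rewrite rmorphN rmorphM fmorphV /= p_conj.
have -> : p + - (q^* / p) * q + (- (q / p) * q^* + - (q / p) * (- (q^* / p) * p))
    = p - q * q^* / p by field.
rewrite qq; by rewrite expr2 mulfK // subrr.
Qed.

(** * Recurrences for KMS matrices and the pencil equation *)

(** With S the superdiagonal shift, J is the sum of the a^k S^k for k >= 1, so J = a S (1 + J). The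
    next lemma is the analogue for the adjoint. *)
Lemma KMS_mulE (C : numClosedFieldType) n (a : C) (x : 'cV[C]_n)
    (i j : 'I_n) :
  i.+1 = j :> nat ->
  (KMS n a *m x) i 0 = a * (x j 0 + (KMS n a *m x) j 0).
Proof.
move=> ij; rewrite !mxE (bigD1 j) //= !mxE -ij ltnSn subSnn expr1 mulrDr.
congr (_ + _); rewrite mulr_sumr big_mkcond /=.
apply: eq_bigr => k _; rewrite !mxE -val_eqE /= -ij.
have [-> /=|neq_k /=] := eqVneq; first by rewrite ltnn mul0r mulr0.
rewrite (ltn_neqAle i.+1) eq_sym neq_k /=; case: ltnP => [lt_ik|]; last first.
  by rewrite !mul0r mulr0.
by rewrite mulrA -exprS subnS prednK // subn_gt0.
Qed.

Lemma KMS_adj_mulE (C : numClosedFieldType) n (a : C) (x : 'cV[C]_n)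
    (i j : 'I_n) :
  i.+1 = j :> nat ->
  ((KMS n a)^t* *m x) j 0 = a^* * (x i 0 + ((KMS n a)^t* *m x) i 0).
Proof.
move=> ij; rewrite !mxE (bigD1 i) //= !mxE -ij ltnSn subSnn expr1 mulrDr.
congr (_ + _); rewrite mulr_sumr big_mkcond /=.
apply: eq_bigr => k _; rewrite !mxE -val_eqE /= -ij ltnS.
have [-> /=|neq_k /=] := eqVneq; first by rewrite ltnn rmorph0 mul0r mulr0.
rewrite leq_eqVlt (negPf neq_k) /=; case: ltnP => [lt_ki|]; last first.
  by rewrite rmorph0 !mul0r mulr0.
by rewrite mulrA -rmorphM -exprS subSn // ltnW.
Qed.

Lemma KMS_mul_last (C : numClosedFieldType) n (a : C) (x : 'cV[C]_n.+1) :
  (KMS n.+1 a *m x) ord_max 0 = 0.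
Proof.
rewrite mxE big1 // => k _; rewrite mxE ltnNge -ltnS ltn_ord /=.
exact: mul0r.
Qed.

Lemma KMS_adj_mul_first (C : numClosedFieldType) n (a : C) (x : 'cV[C]_n.+1) :
  ((KMS n.+1 a)^t* *m x) 0 0 = 0.
Proof. by rewrite mxE big1 // => k _; rewrite !mxE ltn0 rmorph0 mul0r. Qed.

(* The hypothesis on mu expresses that mu = z^* - w * z for some z when w is
   unimodular; it forces w = -1 in the exceptional case mu = -1, where the
   downward recurrence degenerates. *)
Lemma KMS_pencil_eigenvector_eq0 (C : numClosedFieldType) n (a w mu : C)
    (x : 'cV[C]_n.+1) :
  a != 0 -> `|a| != 1 -> w * w^* = 1 -> mu^* = - w^* * mu ->
  (KMS n.+1 a)^t* *m x - w *: (KMS n.+1 a *m x) = mu *: x ->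
  x ord_max 0 = 0 -> x = 0.
Proof.
move=> a_neq0 a_neq1 w1 mu_conj x_eig x_last.
set p := KMS n.+1 a *m x in x_eig; set q := _ *m x in x_eig.
have eig i : q i 0 - w * p i 0 = mu * x i 0.
  by have := congr1 (fun y : 'cV_n.+1 => y i 0) x_eig; rewrite !mxE.
have p_rec (i j : 'I_n.+1) : i.+1 = j :> nat -> p i 0 = a * (x j 0 + p j 0).
  exact: KMS_mulE.
have q_rec (i j : 'I_n.+1) : i.+1 = j :> nat -> q j 0 = a^* * (x i 0 + q i 0).
  exact: KMS_adj_mulE.
have p_last : p ord_max 0 = 0 by exact: KMS_mul_last.
have q_first : q 0 0 = 0 by exact: KMS_adj_mul_first.
have [mu_eq|mu_neq] := eqVneq mu (-1); last first.
  (* Upward from the last coordinate: p_i = 0 and q_i = - x_i follow from the recurrences, and the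
     pencil equation leaves (mu + 1) x_i = 0. *)
  have tail_eq0 k (i : 'I_n.+1) : (i + k = n)%N ->
      [/\ x i 0 = 0, p i 0 = 0 & q i 0 = 0].
    elim: k i => [|k IHk] i ik.
      have -> : i = ord_max by apply: val_inj; rewrite /= -[RHS]ik addn0.
      split=> //; have := eig ord_max.
      by rewrite p_last x_last !mulr0 subr0.
    have j_lt : (i.+1 < n.+1)%N.
      by rewrite ltnS (leq_trans (leq_addr k i.+1)) // addSnnS ik.
    have [|xj pj qj] := IHk (Ordinal j_lt); first by rewrite /= addSnnS.
    have pi0 : p i 0 = 0 by rewrite (p_rec _ (Ordinal j_lt)) // xj pj addr0 mulr0.
    have qi0 : q i 0 = - x i 0.
      apply/eqP; rewrite -addr_eq0 addrC; have /esym/eqP := q_rec i (Ordinal j_lt) erefl.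
      by rewrite qj mulf_eq0 conjC_eq0 (negPf a_neq0).
    have xi0 : x i 0 = 0.
      apply/eqP; have /eqP := eig i; rewrite qi0 pi0 mulr0 subr0 -mulN1r.
      by rewrite -subr_eq0 -mulrBl mulf_eq0 subr_eq0 eq_sym (negPf mu_neq).
    by rewrite pi0 qi0 xi0 oppr0.
  apply/colP => i; rewrite [RHS]mxE.
  have i_le : (i <= n)%N by rewrite -ltnS.
  by have [] := tail_eq0 _ i (subnKC i_le).
have w_eq : w = -1.
  move: mu_conj; rewrite mu_eq mulrNN mulr1 => /(congr1 Num.conj).
  by rewrite !conjCK => <-.
have eig_opp i : p i 0 = - x i 0 - q i 0.
  have := eig i; rewrite w_eq mu_eq !mulN1r opprK => <-.
  by rewrite addrAC subrr add0r.
(* Now p = - x - q, so the recurrences give p_i = - a q_(i+1) = - |a|^2 (x_i + q_i). If q_i = 0,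
   this reads (|a|^2 - 1) x_i = 0. At the last index [x_last] applies instead. *)
have x_eq0 i : q i 0 = 0 -> x i 0 = 0.
  move=> qi0; have [i_lt|i_ge] := ltnP i n; last first.
    rewrite (_ : i = ord_max) //; apply: val_inj; apply/eqP.
    by rewrite eqn_leq i_ge -ltnS ltn_ord.
  have j_lt : (i.+1 < n.+1)%N by [].
  have := p_rec i (Ordinal j_lt) erefl.
  rewrite !eig_opp (q_rec i (Ordinal j_lt)) // qi0 subr0 addr0 => /eqP.
  rewrite -subr_eq0.
  have -> : forall y z : C, - y - a * (z + (- z - a^* * y)) = (a * a^* - 1) * y.
    by move=> y z; ring.
  rewrite mulf_eq0 subr_eq0 -normCK pexpr_eq1 // (negPf a_neq1) /=.
  by move/eqP.
have q_eq0 k (i : 'I_n.+1) : i = k :> nat -> q i 0 = 0.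
  elim: k i => [|k IHk] i ik; first by rewrite (_ : i = 0) //; apply: val_inj.
  have j_lt : (k < n.+1)%N by rewrite ltnW // -ik.
  have qj := IHk (Ordinal j_lt) erefl.
  by rewrite (q_rec (Ordinal j_lt)) // qj x_eq0 // addr0 mulr0.
by apply/colP => i; rewrite [RHS]mxE x_eq0 // (q_eq0 i).
Qed.

(** * Interior points of the numerical range *)

Lemma inner_subZl (C : numClosedFieldType) n (A : 'M[C]_n) c u v :
  inner ((A - c%:M) *m u) v = inner (A *m u) v - c * inner u v.
Proof.
by rewrite mulmxBl mul_scalar_mx -scaleNr innerDl innerZl mulNr.
Qed.

(* Along v = x + s *: h the Rayleigh quotient equals z + zeta exactly when s
   solves an equation covered by perturbed_real_linear_solution. *)
Lemma numrange_interior_direction (C : numClosedFieldType) n (A : 'M[C]_n)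
    (x h : 'cV[C]_n) (z := inner (A *m x) x) :
  inner x x = 1 -> inner h x = 0 ->
  `|inner ((A - z%:M) *m h) x| != `|inner ((A - z%:M) *m x) h| ->
  (numrange A)° z.
Proof.
move=> xx hx neq.
have [d d_gt0 solve] :=
  perturbed_real_linear_solution (inner ((A - z%:M) *m h) h) (inner h h) neq.
apply/nbhs_ballP; exists d => //= w; rewrite /ball /= distrC => /solve[s sE].
have xh : inner x h = 0 by rewrite -inner_conj hx rmorph0.
pose v := x + s *: h.
have vv : inner v v = 1 + s * s^* * inner h h.
  by rewrite /v innerDl !innerDr !innerZl !innerZr xx hx xh; ring.
have vv_neq0 : inner v v != 0.
  rewrite vv gt_eqF // ltr_wpDr ?ltr01 // -normCK.
  by rewrite mulr_ge0 ?exprn_ge0 ?inner_ge0.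
have -> : w = inner (A *m v) v / inner v v.
  apply: (mulIf vv_neq0); rewrite divfK // -[LHS](subrK (z * inner v v)).
  rewrite -mulrBl {1}vv -sE !inner_subZl vv /v mulmxDr -scalemxAr.
  rewrite !innerDl !innerDr !innerZl !innerZr -/z hx xh; ring.
by apply: numrange_quotient; rewrite -inner_eq0.
Qed.

(** Otherwise [numrange_interior_direction] fails for h = B^t* x and h = B x, both orthogonal to x
    because <Bx, x> = 0. The two resulting equalities are those of [unimodular_multiple]. *)
Lemma numrange_interior (C : numClosedFieldType) n (A : 'M[C]_n) (x : 'cV[C]_n)
    (z := inner (A *m x) x) :
  inner x x = 1 ->
  (forall w : C, w * w^* = 1 ->
     (A - z%:M)^t* *m x != w *: ((A - z%:M) *m x)) ->
  (numrange A)° z.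
Proof.
move=> xx indep; set B := A - z%:M in indep.
have Bx : inner (B *m x) x = 0 by rewrite inner_subZl xx mulr1 subrr.
have B'x : inner (B^t* *m x) x = 0.
  by rewrite inner_adj trmxCK -inner_conj Bx rmorph0.
have adjE h : inner (B *m h) x = inner h (B^t* *m x) by rewrite inner_adj.
have [eq1|] := eqVneq `|inner (B *m (B^t* *m x)) x| `|inner (B *m x) (B^t* *m x)|;
  last exact: numrange_interior_direction.
have [eq2|] := eqVneq `|inner (B *m (B *m x)) x| `|inner (B *m x) (B *m x)|;
  last exact: numrange_interior_direction.
have normC : `|inner (B^t* *m x) (B *m x)| = `|inner (B *m x) (B^t* *m x)|.
  by rewrite -inner_conj norm_conjC.
have [|| w w1 wE] := @unimodular_multiple _ _ (B^t* *m x) (B *m x).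
- by rewrite normC -eq1 adjE ger0_norm ?inner_ge0.
- by rewrite normC -adjE eq2 ger0_norm ?inner_ge0.
by have := indep _ w1; rewrite wE eqxx.
Qed.

Lemma KMS_numrange_interior (C : numClosedFieldType) n (a : C)
    (x : 'cV[C]_n.+1) :
  a != 0 -> `|a| != 1 -> inner x x = 1 -> x ord_max 0 = 0 ->
  (numrange (KMS n.+1 a))° (inner (KMS n.+1 a *m x) x).
Proof.
move=> a_neq0 a_neq1 xx x_last; apply: numrange_interior => // w w1.
set z := inner _ _; apply/eqP => x_eig.
have x_neq0 : x != 0 by rewrite -inner_eq0 xx oner_neq0.
have w'w : w^* * w = 1 by rewrite mulrC.
apply/negP: x_neq0; apply/negPn/eqP.
(* Expanding (J - z)^t* x = w (J - z) x gives this value of mu. *)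
apply: (@KMS_pencil_eigenvector_eq0 _ _ a w (z^* - w * z)) => //.
  rewrite rmorphB rmorphM /= conjCK mulrBr mulNr mulrA mulNr w'w; ring.
move: x_eig; rewrite raddfB /= map_mxB tr_scalar_mx map_scalar_mx !mulmxBl !mul_scalar_mx /=.
move: (_^t* *m x) (KMS _ _ *m x) => q p /colP x_eig; apply/colP => i.
by have := x_eig i; rewrite !mxE => /(canRL (subrK _)) ->; ring.
Qed.

(** * Invariant subspaces of KMS matrices *)

(* A row u annihilating the invariant subspace spanned by the columns of X
   yields the annihilating row u *m KMS n a, whose first nonzero entry is one
   place further to the right; the process ends at a multiple of the last unit
   row. *)
Lemma KMS_invariant_last_row (C : numClosedFieldType) n m (a : C)
    (X : 'M[C]_(n.+1, m)) (A : 'M[C]_m) (u : 'rV[C]_n.+1) :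
  a != 0 -> KMS n.+1 a *m X = X *m A -> u != 0 -> u *m X = 0 ->
  forall j, X ord_max j = 0.
Proof.
move=> a_neq0 X_inv.
(* Here i is the leading position of v and k its distance to the last one. *)
suff lead_induction k (v : 'rV[C]_n.+1) (i : 'I_n.+1) : (i + k = n)%N ->
    v 0 i != 0 -> (forall l : 'I_n.+1, (l < i)%N -> v 0 l = 0) -> v *m X = 0 ->
    forall j, X ord_max j = 0.
  move=> u_neq0 uX; have [i ui] : exists i, u 0 i != 0.
    apply/existsP; apply: contra_neqT u_neq0; rewrite negb_exists => /forallP u0.
    by apply/rowP => i; rewrite mxE; apply/eqP; have := u0 i; rewrite negbK.
  case: (@arg_minnP _ i (fun l => u 0 l != 0) (@nat_of_ord _) ui) => i0 ui0 i0_min.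
  have i0_le : (i0 <= n)%N by rewrite -ltnS.
  apply: (lead_induction _ u i0 (subnKC i0_le)) => // j j_lt.
  apply/eqP; apply: contraTT j_lt => /i0_min; by rewrite -leqNgt.
elim: k v i => [|k IHk] v i ik vi v_lt vX.
  have -> : ord_max = i by apply: val_inj; rewrite /= -[LHS]ik addn0.
  move=> j; have := congr1 (fun Y : 'rV_m => Y 0 j) vX; rewrite !mxE (bigD1 i) //=.
  rewrite big1 ?addr0 => [/eqP|l l_neq].
    by rewrite mulf_eq0 (negPf vi) => /eqP.
  rewrite v_lt ?mul0r // ltn_neqAle; apply/andP; split; first by [].
  by rewrite -(addn0 i) ik -ltnS.
have i'_lt : (i.+1 < n.+1)%N.
  by rewrite ltnS (leq_trans (leq_addr k i.+1)) // addSnnS ik.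
apply: (IHk (v *m KMS n.+1 a) (Ordinal i'_lt)).
- by rewrite /= addSnnS.
- rewrite mxE (bigD1 i) //= big1 ?addr0 => [|l l_neq].
    by rewrite mxE /= ltnSn subSnn expr1 mulf_neq0.
  rewrite mxE /= ltnS; case: leqP => [|l_gt]; last by rewrite mulr0.
  rewrite leq_eqVlt (negPf l_neq : (l == i :> nat) = false) => /= l_lt.
  by rewrite v_lt ?mul0r.
- move=> j /=; rewrite ltnS => j_le; rewrite mxE big1 // => l _; rewrite mxE.
  case: ltnP => [l_lt|]; last by rewrite mulr0.
  by rewrite v_lt ?mul0r // (leq_trans l_lt).
- by rewrite -mulmxA X_inv mulmxA vX mul0mx.
Qed.

(** X consists of the first m columns of U^t*, and u is the last row of U, orthogonal to them by
    unitarity; it lies outside the first block because p > 0. *)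
Lemma block_triangular_invariant (C : numClosedFieldType) n m p
    (mp_eq : (m + p)%N = n) (J : 'M[C]_n) (A : 'M[C]_m) (B : 'M[C]_(m, p))
    (D : 'M[C]_p) :
  (0 < p)%N ->
  unitarily_similar J (castmx (mp_eq, mp_eq) (block_mx A B 0 D)) ->
  exists (X : 'M[C]_(n, m)) (u : 'rV[C]_n),
    [/\ X^t* *m X = 1%:M, J *m X = X *m A, u != 0 & u *m X = 0].
Proof.
move=> p_gt0; subst n; rewrite castmx_id.
case: p p_gt0 B D J => // p _ B D J [U U_unitary JE].
pose E : 'M[C]_(m + p.+1, m) := col_mx 1%:M 0.
have UU' : U *m U^t* = 1%:M by apply/unitarymxP.
have U'U : U^t* *m U = 1%:M by apply: mulmx1C.
have TE : block_mx A B 0 D *m E = E *m A.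
  by rewrite mul_block_col mul_col_mx !mulmx0 !addr0 mulmx1 mul1mx !mul0mx.
exists (U^t* *m E), (row (rshift m ord_max) U); split.
- rewrite trmx_mul map_mxM trmxCK mulmxA -(mulmxA _ U) UU' mulmx1.
  by rewrite tr_col_mx map_row_mx mul_row_col trmx1 map_mx1 mulmx1 mulmx0 addr0.
- by rewrite -[RHS]mulmxA -TE JE !mulmxA U'U mul1mx.
- apply/eqP => u0; have := congr1 (fun v => v *m U^t*) u0.
  rewrite /= -row_mul UU' mul0mx => /rowP/(_ (rshift m ord_max))/eqP.
  by rewrite !mxE eqxx oner_eq0.
- rewrite -row_mul mulmxA UU' mul1mx; apply/rowP => j.
  by rewrite mxE col_mxEd !mxE.
Qed.

Unset Implicit Arguments.

Theorem proposition3p5 (R : realType) (n : nat) (n_ge2 : (2 <= n)%N)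
    (a : R[i]) (a_neq0 : `|a| != 0) (a_neq1 : `|a| != 1)
    (m : nat) (m_ge1 : (1 <= m)%N) (m_lt : (m < n)%N)
    (A : 'M[R[i]]_m) (B : 'M[R[i]]_(m, n - m)) (D : 'M[R[i]]_(n - m))
    (JABD : unitarily_similar (KMS n a)
       (castmx (subnKC (ltnW m_lt), subnKC (ltnW m_lt)) (block_mx A B 0 D))) :
  numrange A `<=` (numrange (KMS n a))°.
Proof.
case: n m_lt B D JABD {n_ge2} => // n m_lt B D JABD _ [y /= /enorm_eq1 yy <-].
have [|X [u [X_iso X_inv u_neq0 uX]]] := block_triangular_invariant _ JABD.
  by rewrite subn_gt0.
have a_neq0' : a != 0 by rewrite -normr_eq0.
have inner_X v w : inner (X *m v) (X *m w) = inner v w.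
  by rewrite inner_adj mulmxA X_iso mul1mx.
(* Since X is isometric and intertwines A with J, <Ay, y> = <J X y, X y>, and X y is a unit vector
   with zero last coordinate. *)
rewrite -(inner_X (A *m y)) mulmxA -X_inv -mulmxA.
apply: KMS_numrange_interior => //; first by rewrite inner_X.
rewrite mxE big1 // => j _.
by rewrite (KMS_invariant_last_row a_neq0' X_inv u_neq0 uX) mul0r.
Qed.
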